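(* For every $2\le m,n\le\infty$, the class $\mathcal A_{T_{m,n}}$ does not have EPPA.
   Context: For $2\le m,n\le\infty$, $T_{m,n}$ is the countable connected regular tree-like graph in which every block (maximal 2-connected subgraph) is a clique of order $n$ and every vertex is a cut vertex lying in exactly $m$ blocks. $\mathcal A_{T_{m,n}}$ is the age (class of finite substructures) of the metric space on the vertices of $T_{m,n}$ with the graph (shortest-path) distance. A class $\mathcal K$ has EPPA if for every $\mathbf A\in\mathcal K$ there is $\mathbf B\in\mathcal K$ containing $\mathbf A$ as a substructure such that every isomorphism between substructures of $\mathbf A$ extends to an automorphism of $\mathbf B$. *)

(* Defs.v *)
From mathcomp Require Import all_boot.
From mathcomp Require Import boolp classical_sets functions cardinality.

Set Implicit Arguments.
Unset Strict Implicit.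
Unset Printing Implicit Defensive.

Local Open Scope classical_set_scope.
Local Open Scope card_scope.

#[local] Obligation Tactic := idtac.

(* Elements of {0, 1, 2, ...} together with infinity, which is [None]. *)
Definition extnat := option nat.

Definition two_le (k : extnat) : Prop := if k is Some j then 2 <= j else True.

(* Infinity means countably infinite: all sets measured below are sets of
   vertices, or of blocks, of a countable graph. *)
Definition has_order (T : Type) (X : set T) (k : extnat) : Prop :=
  match k with
  | Some j => X #= `I_j
  | None => X #= [set: nat]
  end.

Record graph := Graph {
  vertex :> Type;
  adj : vertex -> vertex -> Prop;
  adj_sym : forall x y, adj x y -> adj y x;
  adj_irrefl : forall x, ~ adj x x }.

Record subgraph (G : graph) := Subgraph {
  sub_vertices : set G;
  sub_adj : G -> G -> Prop;
  sub_adj_sym : forall x y, sub_adj x y -> sub_adj y x;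
  sub_adj_vertices : forall x y, sub_adj x y -> sub_vertices x /\ sub_vertices y;
  sub_adj_adj : forall x y, sub_adj x y -> adj x y }.

Section Graphs.
Variable G : graph.
Implicit Types (H K : subgraph G) (v x y : G).

Definition subgraph_le H K : Prop :=
  sub_vertices H `<=` sub_vertices K /\
  (forall x y, sub_adj H x y -> sub_adj K x y).

Program Definition whole : subgraph G := @Subgraph G [set: G] (@adj G) _ _ _.
Next Obligation. exact: adj_sym. Qed.
Next Obligation. by []. Qed.
Next Obligation. by []. Qed.

Program Definition delete_vertex H v : subgraph G :=
  @Subgraph G (sub_vertices H `\ v)
    (fun x y => [/\ sub_adj H x y, x <> v & y <> v]) _ _ _.
Next Obligation.
by move=> H v x y [hxy xv yv]; split=> //; apply: sub_adj_sym.
Qed.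
Next Obligation.
by move=> H v x y [/sub_adj_vertices[hx hy] xv yv]; split; split.
Qed.
Next Obligation. by move=> H v x y [/sub_adj_adj]. Qed.

Inductive walk H : nat -> G -> G -> Prop :=
| walk_nil x : sub_vertices H x -> walk H 0 x x
| walk_cons k x y z : sub_adj H x y -> walk H k y z -> walk H k.+1 x z.

Definition connected H : Prop :=
  forall x y, sub_vertices H x -> sub_vertices H y -> exists k, walk H k x y.

(* As usual for blocks, the complete graph on two vertices counts as
   2-connected, so that the blocks of a tree are its edges. *)
Definition two_connected H : Prop :=
  [/\ exists x y, [/\ sub_vertices H x, sub_vertices H y & x <> y],
      connected H
    & forall v, sub_vertices H v -> connected (delete_vertex H v)].

Definition block H : Prop :=
  two_connected H /\
  (forall K, two_connected K -> subgraph_le H K -> subgraph_le K H).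

Definition clique H : Prop :=
  forall x y, sub_vertices H x -> sub_vertices H y -> x <> y -> sub_adj H x y.

(* For connected [G]. *)
Definition cut_vertex v : Prop := ~ connected (delete_vertex whole v).

(* The length of a shortest walk from [x] to [y]; junk value 0 if none. *)
Definition graph_dist x y : nat :=
  if pselect (exists k, `[< walk whole k x y >]) is left ex then ex_minn ex
  else 0.

End Graphs.

(* The graph [G] is the tree-like graph T_{m,n}; these conditions determine it
   up to isomorphism. *)
Record is_T (m n : extnat) (G : graph) : Prop := IsT {
  T_nonempty : [set: G] !=set0;
  T_countable : countable [set: G];
  T_connected : connected (whole G);
  T_block_clique : forall B : subgraph G, block B -> clique B;
  T_block_order : forall B : subgraph G, block B -> has_order (sub_vertices B) n;
  T_cut_vertex : forall v : G, cut_vertex v;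
  T_vertex_blocks : forall v : G,
    has_order [set B : subgraph G | block B /\ sub_vertices B v] m }.

(* Integer distances suffice for graph metrics and their subspaces. *)
Record metric_space := MetricSpace {
  point :> Type;
  dist : point -> point -> nat;
  dist_eq0 : forall x y, dist x y = 0 <-> x = y;
  dist_sym : forall x y, dist x y = dist y x;
  dist_triangle : forall x y z, dist x z <= dist x y + dist y z }.

Definition embedding (A B : metric_space) (f : A -> B) : Prop :=
  injective f /\ (forall x y, dist (f x) (f y) = dist x y).

Definition isomorphism (A B : metric_space) (f : A -> B) : Prop :=
  bijective f /\ (forall x y, dist (f x) (f y) = dist x y).

Definition automorphism (A : metric_space) (f : A -> A) : Prop :=
  isomorphism f.

Program Definition substructure (A : metric_space) (D : set A) : metric_space :=
  @MetricSpace (set_type D) (fun x y => dist (\val x) (\val y)) _ _ _.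
Next Obligation.
move=> A D x y; split; first by move/dist_eq0/val_inj.
by move=> ->; apply/dist_eq0.
Qed.
Next Obligation. by move=> A D x y; apply: dist_sym. Qed.
Next Obligation. by move=> A D x y z; apply: dist_triangle. Qed.

(* Up to isomorphism: the finite metric spaces embeddable in [M]. *)
Definition age (M A : metric_space) : Prop :=
  finite_set [set: A] /\ (exists f : A -> M, embedding f).

Definition EPPA (C : metric_space -> Prop) : Prop :=
  forall A, C A ->
  exists B, C B /\
  exists2 i : A -> B, embedding i &
    forall (D E : set A) (f : substructure D -> substructure E),
      isomorphism f ->
      exists2 g : B -> B, automorphism g &
        forall x : substructure D, g (i (\val x)) = i (\val (f x)).

Section GraphMetric.
Variables (G : graph) (connG : connected (whole G)).
Implicit Types x y z : G.

Lemma graph_distP x y :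
  walk (whole G) (graph_dist x y) x y /\
  (forall k, walk (whole G) k x y -> graph_dist x y <= k).
Proof.
rewrite /graph_dist; case: pselect => [ex|nex].
  case: ex_minnP => k /asboolP wk mink; split=> // j wj.
  by apply: mink; apply/asboolP.
exfalso; apply: nex; have [k wk] := connG (x := x) (y := y) I I.
by exists k; apply/asboolP.
Qed.

Lemma walk_cat j k x y z :
  walk (whole G) j x y -> walk (whole G) k y z -> walk (whole G) (j + k) x z.
Proof.
by elim=> // {}j a b c ab _ IH /IH; rewrite addSn; apply: walk_cons.
Qed.

Lemma walk_sym k x y : walk (whole G) k x y -> walk (whole G) k y x.
Proof.
elim=> [a _|{}k a b c ab _ IH]; first exact: walk_nil.
rewrite -addn1; apply: walk_cat IH _.
by apply: walk_cons (walk_nil (H := whole G) I); apply: sub_adj_sym.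
Qed.

Lemma graph_dist_eq0 x y : graph_dist x y = 0 <-> x = y.
Proof.
split=> [d0|->].
  by have [w _] := graph_distP x y; rewrite d0 in w; inversion w.
apply/eqP; rewrite -leqn0; apply: (graph_distP y y).2; exact: walk_nil.
Qed.

Lemma graph_dist_sym x y : graph_dist x y = graph_dist y x.
Proof.
apply/eqP; rewrite eqn_leq !(fun a b => (graph_distP a b).2) //.
- exact: walk_sym (graph_distP x y).1.
- exact: walk_sym (graph_distP y x).1.
Qed.

Lemma graph_dist_triangle x y z :
  graph_dist x z <= graph_dist x y + graph_dist y z.
Proof.
exact: (graph_distP x z).2 (walk_cat (graph_distP x y).1 (graph_distP y z).1).
Qed.

Definition graph_metric : metric_space :=
  @MetricSpace G (@graph_dist G) graph_dist_eq0 graph_dist_sym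
    graph_dist_triangle.

End GraphMetric.

(* Main.v *)
From mathcomp Require Import all_boot zify.
From mathcomp Require Import boolp classical_sets functions cardinality.
Require Import Defs.

(** Let x0, x1, x2 be consecutive vertices of a geodesic, and let g be an
    automorphism of a finite subspace B extending x0 |-> x1, x1 |-> x2.  The
    orbit of x0 under g is a walk in which vertices two steps apart are at
    distance 2.  As B is finite, this walk returns to a visited vertex, and a
    shortest return is a cycle.  A cycle lies in a block, which is a clique, so
    that two of its vertices two steps apart are adjacent: a contradiction. *)

Set Implicit Arguments.
Unset Strict Implicit.
Unset Printing Implicit Defensive.

Local Open Scope classical_set_scope.

#[local] Obligation Tactic := idtac.

(** * Reachability in subgraphs and under vertex deletion *)

Section Linked.
Variable G : graph.
Implicit Types (H K : subgraph G) (v x y z : G).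

Definition linked H x y : Prop := exists k, walk H k x y.

Lemma linked_refl H x : sub_vertices H x -> linked H x x.
Proof. by move=> Hx; exists 0; apply: walk_nil. Qed.

Lemma linked_edge H x y : sub_adj H x y -> linked H x y.
Proof.
move=> xy; exists 1; apply: (walk_cons xy); apply: walk_nil.
exact: (sub_adj_vertices xy).2.
Qed.

Lemma linked_trans H x y z : linked H x y -> linked H y z -> linked H x z.
Proof.
case=> j; elim=> // {}j a b c ab _ IH /IH [k w].
by exists k.+1; apply: walk_cons ab w.
Qed.

Lemma linked_sym H x y : linked H x y -> linked H y x.
Proof.
case=> j; elim=> [a Ha|{}j a b c ab _ IH]; first exact: linked_refl.
by apply: (linked_trans IH); apply: linked_edge; apply: sub_adj_sym.
Qed.

Lemma linked_le H K x y : subgraph_le H K -> linked H x y -> linked K x y.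
Proof.
move=> [Vle Ele] [j]; elim=> [a /Vle|{}j a b c /Ele ab _ IH].
  exact: linked_refl.
exact: linked_trans (linked_edge ab) IH.
Qed.

Lemma connected_via H x :
  (forall y, sub_vertices H y -> linked H y x) -> connected H.
Proof.
by move=> Hx y z /Hx yx /Hx zx; apply: linked_trans yx _; apply: linked_sym.
Qed.

Lemma delete_vertex_le H K v :
  subgraph_le H K -> subgraph_le (delete_vertex H v) (delete_vertex K v).
Proof.
move=> [Vle Ele]; split=> [x [/Vle Kx xv]//|x y [/Ele xy xv yv]].
by split.
Qed.

Lemma delete_vertex_notin H v :
  ~ sub_vertices H v -> subgraph_le H (delete_vertex H v).
Proof.
move=> Hv; split=> [x Hx|x y xy]; first by split=> // xv; rewrite xv in Hx.
by have [Hx Hy] := sub_adj_vertices xy; split=> // e; apply: Hv; rewrite -e.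
Qed.

(** In a union of subgraphs the deleted vertex may lie outside a given member [H]; deleting it then
    leaves [H] intact. *)
Lemma two_connected_delete H v :
  two_connected H -> connected (delete_vertex H v).
Proof.
move=> [_ cH cHv]; have [Hv|Hv] := pselect (sub_vertices H v); first exact: cHv.
move=> x y [Hx _] [Hy _].
exact: linked_le (delete_vertex_notin Hv) (cH _ _ Hx Hy).
Qed.

End Linked.

(** * The block above a 2-connected subgraph *)

Section BlockContaining.
Variables (G : graph) (C : subgraph G).

(** Taking the union of all candidates yields the block above a 2-connected [C] without a maximality
    principle, even when [G] is infinite. *)
Program Definition two_connected_hull : subgraph G :=
  @Subgraph G
    [set x | exists H, [/\ two_connected H, subgraph_le C H & sub_vertices H x]]
    (fun x y => exists H,
       [/\ two_connected H, subgraph_le C H & sub_adj H x y]) _ _ _.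
Next Obligation.
by move=> x y [H [? ? xy]]; exists H; split=> //; apply: sub_adj_sym.
Qed.
Next Obligation.
by move=> x y [H [? ? /sub_adj_vertices[? ?]]]; split; exists H; split.
Qed.
Next Obligation. by move=> x y [H [_ _ /sub_adj_adj]]. Qed.

Lemma two_connected_hull_ub H :
  two_connected H -> subgraph_le C H -> subgraph_le H two_connected_hull.
Proof. by move=> tH CH; split=> [x|x y] Hx; exists H; split. Qed.

(* Any two members of the union share two vertices of [C], and at least one of
   these survives the deletion of a vertex. *)
Lemma two_connected_hull_block : two_connected C -> block two_connected_hull.
Proof.
move=> tC; have CC : subgraph_le C C by split.
have [[a [b [Ca Cb ab]]] _ _] := tC.
have leC := two_connected_hull_ub tC CC.
split; last first.
  (* Maximality: a 2-connected [K] above the union lies above [C], hence is itself one of the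
     members. *)
  move=> K tK [VK EK]; apply: two_connected_hull_ub => //.
  by split=> [x /leC.1/VK|x y /leC.2/EK].
split.
- by exists a, b; split=> //; apply: leC.1.
- apply: (@connected_via _ _ a) => y [H [tH CH Hy]].
  apply: linked_le (two_connected_hull_ub tH CH) _.
  by case: tH => _ cH _; apply: cH => //; apply: CH.1.
- move=> v _.
  have [c Cc cv] : exists2 c, sub_vertices C c & c <> v.
    have [av|av] := pselect (a = v); last by exists a.
    by exists b => // bv; apply: ab; rewrite av bv.
  apply: (@connected_via _ _ c) => y [[H [tH CH Hy]] yv].
  apply: linked_le (delete_vertex_le v (two_connected_hull_ub tH CH)) _.
  by apply: two_connected_delete => //; split=> //; apply: CH.1.
Qed.

End BlockContaining.

(** * Cycles are 2-connected and acquire chords from clique blocks *)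

Section Cycle.
Variables (G : graph) (x : nat -> G) (k : nat).
Hypothesis k_gt2 : 2 < k.
Hypothesis x_adj : forall t, adj (x t) (x t.+1).
Hypothesis x_closed : x k = x 0.
Hypothesis x_inj : forall s t, s < t < k -> x s <> x t.

Program Definition cycle_graph : subgraph G :=
  @Subgraph G [set y | exists2 t, t < k & y = x t]
    (fun y z => exists2 t, t < k &
       (y = x t /\ z = x t.+1) \/ (z = x t /\ y = x t.+1)) _ _ _.
Next Obligation. by move=> y z [t tk []] e; exists t => //; [right|left]. Qed.
Next Obligation.
have Vx t : t < k -> exists2 s, s < k & x t.+1 = x s.
  rewrite leq_eqVlt => /orP[/eqP tk|]; last by exists t.+1.
  by exists 0; rewrite ?tk //; case: (k) k_gt2.
by move=> y z [t tk [] [-> ->]]; split; (try by exists t); apply: Vx.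
Qed.
Next Obligation.
by move=> y z [t tk [] [-> ->]] //; apply: adj_sym.
Qed.

(** Walk forward along the arc from [x s] to [x t]. Allowing [t = k] lets the arc close up at
    [x k = x 0]. *)
Lemma cycle_segment v s t : s <= t <= k -> s < k ->
  (forall r, s <= r <= t -> x r <> v) ->
  linked (delete_vertex cycle_graph v) (x s) (x t).
Proof.
move=> + sk; elim: t => [|t IH] /andP[st tk] nv.
  move: st nv; rewrite leqn0 => /eqP -> nv; apply: linked_refl.
  by split; [exists 0 => //; case: (k) k_gt2|apply: nv].
move: st; rewrite leq_eqVlt => /orP[/eqP es|st].
  rewrite -es; apply: linked_refl.
  by split; [exists s|apply: nv; rewrite es !leqnn].
have {}IH : linked (delete_vertex cycle_graph v) (x s) (x t).
  apply: IH; first by rewrite -ltnS st ltnW.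
  by move=> r /andP[sr rt]; apply: nv; rewrite sr ltnW.
apply: linked_trans IH _; apply: linked_edge.
split; first by exists t => //; left.
  by apply: nv; rewrite -ltnS st leqnSn.
by apply: nv; rewrite ltnW //= leqnn.
Qed.

(** Deleting [x s] leaves a single arc. For [s = 0] every remaining vertex is joined to [x 1];
    otherwise to [x 0], backwards from positions before [s] and forwards through [x k = x 0] from
    positions after [s]. *)
Lemma cycle_delete_connected v : sub_vertices cycle_graph v ->
  connected (delete_vertex cycle_graph v).
Proof.
case=> s sk ->; have k_gt0 : 0 < k by case: (k) k_gt2.
have x_neq r t : r < k -> t < k -> r != t -> x r <> x t.
  move=> rk tk; rewrite neq_ltn => /orP[rt|tr].
    by apply: x_inj; rewrite rt.
  by move=> e; apply: (@x_inj t r); rewrite ?tr.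
have [s0|s_gt0] := posnP s.
  apply: (@connected_via _ _ (x 1)) => _ [[t tk ->] ts].
  have t_gt0 : 0 < t by case: (posnP t) ts => // -> []; rewrite s0.
  apply: linked_sym; apply: cycle_segment; rewrite ?t_gt0 ?(ltnW tk) //.
    exact: ltn_trans k_gt2.
  move=> r /andP[r_gt0 rt]; apply: x_neq => //; first exact: leq_ltn_trans tk.
  by rewrite s0 -lt0n.
apply: (@connected_via _ _ (x 0)) => _ [[t tk ->] ts].
have [lt_ts|lt_st|eq_ts] := ltngtP t s; last by case: ts; rewrite eq_ts.
  apply: linked_sym; apply: cycle_segment; rewrite ?(ltnW tk) //.
  move=> r /andP[_ rt]; have rs := leq_ltn_trans rt lt_ts.
  by apply: x_neq => //; [exact: ltn_trans sk|rewrite ltn_eqF].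
rewrite -x_closed; apply: cycle_segment; rewrite ?leqnn ?(ltnW tk) //.
move=> r /andP[tr rk]; have sr := leq_trans lt_st tr.
move: rk; rewrite leq_eqVlt => /orP[/eqP ->|rk].
  by rewrite x_closed; apply: x_neq => //; rewrite ltn_eqF.
by apply: x_neq => //; rewrite gtn_eqF.
Qed.

Lemma cycle_two_connected : two_connected cycle_graph.
Proof.
have k_gt0 : 0 < k by case: (k) k_gt2.
split; last exact: cycle_delete_connected.
  exists (x 0), (x 1); have k_gt1 : 1 < k by apply: ltn_trans k_gt2.
  by split; [exists 0|exists 1|apply: x_inj].
apply: (@connected_via _ _ (x 0)) => _ [t tk ->].
elim: t tk => [|t IH] tk; first by apply: linked_refl; exists 0.
apply: linked_trans (IH (ltnW tk)); apply: linked_sym; apply: linked_edge.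
by exists t; [exact: ltnW|left].
Qed.

Lemma cycle_chord : (forall B : subgraph G, block B -> clique B) ->
  adj (x 0) (x 2).
Proof.
move=> blocks; have C2 := cycle_two_connected.
have CH := two_connected_hull_ub C2 (conj (fun _ h => h) (fun _ _ h => h)).
apply: (@sub_adj_adj _ (two_connected_hull cycle_graph)).
apply: blocks; first exact: two_connected_hull_block.
- by apply: CH.1; exists 0 => //; case: (k) k_gt2.
- by apply: CH.1; exists 2.
- exact: x_inj.
Qed.

End Cycle.

(** * Geodesics and local geodesics in the graph metric *)

Section Distances.
Variables (G : graph) (connG : connected (whole G)).
Local Notation d := (@graph_dist G).

Lemma graph_dist_adj x y : adj x y -> d x y <= 1.
Proof.
move=> xy; apply: (graph_distP connG x y).2.
by apply: (@walk_cons _ (whole G) _ _ _ _ xy); apply: walk_nil.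
Qed.

Lemma graph_dist1_adj x y : d x y = 1 -> adj x y.
Proof.
move=> d1; have [w _] := graph_distP connG x y; rewrite d1 in w.
inversion w as [|k a b c ab w' e1 e2 e3]; subst.
by inversion w'; subst.
Qed.

Lemma walk_dist k x y : walk (whole G) k x y -> d x y <= k.
Proof. exact: (graph_distP connG x y).2. Qed.

(** Two vertices separated by [v] are neither equal nor adjacent, so a shortest walk between them
    has at least two edges; its first three vertices serve. *)
Lemma geodesic2_exists (v : G) : cut_vertex v ->
  exists x0 x1 x2, [/\ d x0 x1 = 1, d x1 x2 = 1 & d x0 x2 = 2].
Proof.
move=> /existsNP[y] /existsNP[z] /not_implyP[Hy] /not_implyP[Hz nyz].
have [+ _] := graph_distP connG y z.
move E : (d y z) => k w.
case: k y z / w E nyz Hy Hz => [a _ _ nyz Hy _|k a b c ab w].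
  by case: nyz; apply: linked_refl.
case: k b c / w ab => [b _ ab _ nyz [_ ya] [_ yb]|k b b' c bb' w ab dac _ _ _].
  by case: nyz; apply: linked_edge; split.
exists a, b, b'; have := walk_dist w.
have := graph_dist_adj ab; have := graph_dist_adj bb'.
have := graph_dist_triangle connG a b b'.
have := graph_dist_triangle connG a b' c.
by move: dac; move: (d _ _) (d _ _) (d _ _) (d _ _) (d _ _) => *; split; lia.
Qed.

Lemma local_geodesic_inj (z : nat -> G) :
  (forall B : subgraph G, block B -> clique B) ->
  (forall t, d (z t) (z t.+1) = 1) -> (forall t, d (z t) (z t.+2) = 2) ->
  injective z.
Proof.
move=> blocks d1 d2.
(* Return times are minimised over all starting points [s] at once, so that a repetition inside a
   shortest return would give a shorter one. *)
pose P k := (0 < k) && `[< exists s, z s = z (s + k) >].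
have nP : ~ exists k, P k.
  move=> exP; case: (ex_minnP exP) => k /andP[k_gt0 /asboolP[s zs]] kmin.
  (* A return after one or two steps would make a distance of 1 or 2 vanish. *)
  have k_gt2 : 2 < k.
    move: k_gt0 zs; case: (k) => [//|[|[|//]]] _ zs.
      have := d1 s; rewrite -addn1 -zs.
      by rewrite (graph_dist_eq0 connG _ _).2.
    have := d2 s; rewrite -addn2 -zs.
    by rewrite (graph_dist_eq0 connG _ _).2.
  have : adj (z (s + 0)) (z (s + 2)).
    apply: (@cycle_chord _ (fun t => z (s + t)) k) => //.
    - by move=> t; rewrite addnS; apply: graph_dist1_adj.
    - by rewrite addn0.
    - move=> i j /andP[ij jk] zij.
      have : P (j - i).
        rewrite /P subn_gt0 ij; apply/asboolP; exists (s + i).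
        by rewrite zij; congr z; lia.
      by move/kmin; lia.
  by rewrite addn0 addn2 => /graph_dist_adj; rewrite d2.
have lt_neq s t : s < t -> z s <> z t.
  move=> st e; apply: nP; exists (t - s).
  by rewrite /P subn_gt0 st; apply/asboolP; exists s; rewrite subnKC // ltnW.
by move=> s t e; case: (ltngtP s t) => // /lt_neq; rewrite e.
Qed.

End Distances.

(** * The three-point path as a witness against EPPA *)

(** Subtraction is truncated, so the sum is the absolute difference of [i] and [j]. *)
Program Definition path3 : metric_space :=
  @MetricSpace 'I_3 (fun i j : 'I_3 => (i - j) + (j - i)) _ _ _.
Next Obligation.
move=> i j; split=> [e|->]; last by rewrite subnn.
by apply: val_inj => /=; lia.
Qed.
Next Obligation. by move=> i j; rewrite /= addnC. Qed.
Next Obligation. by move=> i j k; lia. Qed.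

Lemma path3_age (G : graph) (connG : connected (whole G)) (v : G) :
  cut_vertex v -> age (graph_metric connG) path3.
Proof.
move=> /(geodesic2_exists connG)[x0 [x1 [x2 [d01 d12 d02]]]].
split; first exact: finite_finset.
pose f (i : path3) : graph_metric connG := nth x0 [:: x0; x1; x2] (i : 'I_3).
have fd i j : dist (f i) (f j) = dist i j.
  have d0 := fun x => (graph_dist_eq0 connG x x).2 erefl.
  have sym := graph_dist_sym connG.
  rewrite /f /=; case: i j => [[|[|[|//]]] ?] [[|[|[|//]]] ?] //=;
    by rewrite ?d0 // sym.
exists f; split=> // i j fij; apply/dist_eq0; rewrite -fd; exact/dist_eq0.
Qed.

(** This lets a partial isomorphism be given by a total map [h] with arbitrary values off [D]:
    corestricted to the image of [D], an isometric map is bijective. *)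
Lemma EPPA_extend (A B : metric_space) (i : A -> B) (D : set A) (h : A -> A) :
  (forall (D E : set A) (f : substructure D -> substructure E),
      isomorphism f ->
      exists2 g : B -> B, automorphism g &
        forall x : substructure D, g (i (\val x)) = i (\val (f x))) ->
  {in D &, forall x y, dist (h x) (h y) = dist x y} ->
  exists2 g : B -> B, automorphism g & forall x, D x -> g (i x) = i (h x).
Proof.
move=> ext hD.
have hDin (x : set_type D) : h (\val x) \in h @` D.
  by rewrite inE; exists (\val x) => //; rewrite -inE; apply: valP.
pose f (x : substructure D) : substructure (h @` D) :=
  exist _ (h (\val x)) (hDin x).
have fd x y : dist (f x) (f y) = dist x y by apply: hD; apply: valP.
have [|g gaut gf] := ext D (h @` D) f.
  split=> //; rewrite -setTT_bijective; split=> //.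
  - by move=> x y _ _ e; apply/dist_eq0; rewrite -fd; apply/dist_eq0.
  - move=> [y hy] _; have := hy; rewrite inE => -[x Dx hxy].
    have xD : x \in D by rewrite inE.
    by exists (exist _ x xD) => //; apply: val_inj.
exists g => // x Dx; have xD : x \in D by rewrite inE.
exact: gf (exist _ x xD).
Qed.

Theorem theorem8p5 (m n : extnat) (hm : two_le m) (hn : two_le n)
    (G : graph) (hG : is_T m n G) :
  ~ EPPA (age (graph_metric (T_connected hG))).
Proof.
have connG := T_connected hG.
move=> eppa; have [v _] := T_nonempty hG.
have [B [[Bfin [e [einj ed]]] [i [_ idist] ext]]] :=
  eppa _ (path3_age (T_connected hG) (@T_cut_vertex _ _ _ hG v)).
(* The shift 0 to 1, 1 to 2, used on the domain [j < 2]; at 2 the value of [inord] is a default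
   outside that domain. *)
pose h (j : path3) : path3 := inord (j : 'I_3).+1.
have [|g [_ gd] gi] := @EPPA_extend _ _ i [set j : 'I_3 | j < 2] h ext.
  by move=> [j ?] [k ?]; rewrite !inE /= => j2 k2; rewrite !inordK //; lia.
pose p0 : path3 := inord 0; pose z t := iter t g (i p0).
have iter_d t x y : dist (iter t g x) (iter t g y) = dist x y.
  by elim: t => //= t <-; apply: gd.
have z1 : z 1 = i (h p0) by apply: gi; rewrite /= inordK.
have z2 : z 2 = i (h (h p0)).
  by rewrite -[z 2]/(g (z 1)) z1; apply: gi; rewrite /= /h !inordK.
(* The [t]-th iterate of [g] is an isometry, so the distances along the orbit are read off from its
   first three points. *)
have zd j t : dist (z t) (z (t + j)) = dist (z 0) (z j).
  by rewrite /z iterD iter_d.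
(* The orbit lives in [B]; the embedding [e] moves it into [G], where blocks are available. *)
have z_inj : injective (e \o z).
  apply: (local_geodesic_inj connG (T_block_clique hG)) => t.
  - rewrite -[LHS]/(dist (e (z t)) (e (z t.+1))) ed -addn1 zd z1 idist.
    by rewrite /= /h !inordK.
  - rewrite -[LHS]/(dist (e (z t)) (e (z t.+2))) ed -addn2 zd z2 idist.
    by rewrite /= /h !inordK.
(* An injective [z] would make the set of naturals, as preimage of the finite [B], finite. *)
apply: infinite_nat; apply: (@sub_finite_set _ _ (z @^-1` [set: B])) => //.
by apply: finite_preimage => // s t _ _ zst; apply: z_inj; rewrite /= zst.
Qed.
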